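(* Let $G=(V,E)$ be a finite undirected graph with $n=|V|$ vertices and let $W$ be a gossip matrix on $G$. Let $\gamma\in(0,2)$ be a lower bound on the spectral gap of $W$ and let $d$ be any positive real number. Let $\xi=(\xi_v)_{v\in V}$ be any family of real initial observations, with average $\bar\xi=\frac1n\sum_{v\in V}\xi_v$, and let $x^t=(x^t_v)_{v\in V}$ be the iterates generated by the Jacobi polynomial iteration with spectral gap, with parameters $d$ and $\gamma$. Then $$\limsup_{t\to\infty}\Vert x^t-\bar\xi\,\mathbf{1}\Vert_2^{1/t}\ \le\ \frac{1-\gamma/2}{(1+\sqrt{\gamma/2})^2}.$$
   Context: Gossip matrix: a matrix $W=(W_{v,w})_{v,w\in V}$ that is entrywise nonnegative, supported by $G$ (for distinct $v,w$, $W_{v,w}>0$ implies $\{v,w\}\in E$), stochastic ($\sum_w W_{v,w}=1$ for all $v$) and symmetric. Its eigenvalues are $1=\lambda_1\ge\lambda_2\ge\dots\ge\lambda_n\ge-1$, with $\lambda_1=1$ corresponding to the all-ones vector $\mathbf{1}$. The spectral gap is $1-\lambda_2$. Jacobi polynomial iteration with spectral gap (parameters $d,\gamma$): $x^t=y^t/\delta_t$, where $y^0=\xi$, $\delta_0=1$, $y^1=\tilde a_0W\xi+\tilde b_0\xi$, $\delta_1=\tilde a_0+\tilde b_0$, and for $t\ge1$ $$y^{t+1}=\tilde a_tWy^t+\tilde b_ty^t-\tilde c_ty^{t-1},\qquad \delta_{t+1}=(\tilde a_t+\tilde b_t)\delta_t-\tilde c_t\delta_{t-1},$$ with $\tilde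 a_t=a_t(1-\gamma/2)^{-1}$ and $\tilde b_t=b_t+\frac{\gamma}{2}(1-\gamma/2)^{-1}a_t$ for $t\ge0$, $\tilde c_t=c_t$ for $t\ge1$, where $a_0=\frac{d+4}{2(2+d)}$, $b_0=\frac{d}{2(2+d)}$, and for $t\ge 1$ $$a_t=\frac{(2t+d/2+1)(2t+d/2+2)}{2(t+1+d/2)^2},\quad b_t=\frac{d^2(2t+d/2+1)}{8(t+1+d/2)^2(2t+d/2)},\quad c_t=\frac{t^2(2t+d/2+2)}{(t+1+d/2)^2(2t+d/2)}.$$ *)

(* Defs.v *)
From HB Require Import structures.
From mathcomp Require Import all_boot all_order all_algebra.
From mathcomp Require Import polyrcf.
From mathcomp Require Import all_classical all_reals all_analysis.

Set Implicit Arguments.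
Unset Strict Implicit.
Unset Printing Implicit Defensive.

Import Order.TTheory GRing.Theory Num.Theory.
Import numFieldNormedType.Exports.
Local Open Scope ring_scope.

(* The graph is given by its adjacency relation [e] on the vertex set [V];
   matrices and vectors indexed by [V] are plain functions. *)
Record gossip_matrix (R : realType) (V : finType) (e : rel V)
    (W : V -> V -> R) : Prop := GossipMatrix {
  gossip_ge0 : forall v w, 0 <= W v w;
  gossip_support : forall v w, v != w -> 0 < W v w -> e v w;
  gossip_stochastic : forall v, \sum_w W v w = 1;
  gossip_symmetric : forall v w, W v w = W w v }.

Definition matrix_of (R : realType) (V : finType) (W : V -> V -> R) :
    'M[R]_#|V| :=
  \matrix_(i, j) W (enum_val i) (enum_val j).

(* Real eigenvalues, repeated with their multiplicity as roots of the
   characteristic polynomial, in nonincreasing order. *)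
Definition eigenvalues (R : realType) (n : nat) (A : 'M[R]_n) : seq R :=
  flatten [seq nseq (mup x (char_poly A)) x | x <- rev (rootsR (char_poly A))].

(* 1 - lambda_2, the list being indexed from 0. If #|V| <= 1 there is no
   lambda_2; the default value -1, the least possible eigenvalue of a gossip
   matrix, makes the gap 2, so that every gamma in (0, 2) is a lower bound. *)
Definition spectral_gap (R : realType) (V : finType) (W : V -> V -> R) : R :=
  1 - nth (-1) (eigenvalues (matrix_of W)) 1.

Section Coefficients.
Variables (R : realType) (d gamma : R).

Definition jacobi_a (t : nat) : R :=
  if t == 0%N then (d + 4) / (2 * (2 + d))
  else ((2 * t%:R + d / 2 + 1) * (2 * t%:R + d / 2 + 2)) /
       (2 * (t%:R + 1 + d / 2) ^+ 2).

Definition jacobi_b (t : nat) : R :=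
  if t == 0%N then d / (2 * (2 + d))
  else (d ^+ 2 * (2 * t%:R + d / 2 + 1)) /
       (8 * (t%:R + 1 + d / 2) ^+ 2 * (2 * t%:R + d / 2)).

(* Only used for t >= 1. *)
Definition jacobi_c (t : nat) : R :=
  (t%:R ^+ 2 * (2 * t%:R + d / 2 + 2)) /
  ((t%:R + 1 + d / 2) ^+ 2 * (2 * t%:R + d / 2)).

Definition gap_a (t : nat) : R := jacobi_a t * (1 - gamma / 2)^-1.

Definition gap_b (t : nat) : R :=
  jacobi_b t + gamma / 2 * (1 - gamma / 2)^-1 * jacobi_a t.

Definition gap_c (t : nat) : R := jacobi_c t.

End Coefficients.

Section Iteration.
Variables (R : realType) (V : finType) (W : V -> V -> R).
Variables (d gamma : R) (xi : V -> R).

Let a := gap_a d gamma.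
Let b := gap_b d gamma.
Let c := gap_c d.

Definition gossip (y : V -> R) : V -> R := fun v => \sum_w W v w * y w.

Fixpoint jacobi_y (t : nat) : V -> R :=
  match t with
  | 0 => xi
  | (s.+1 as t').+1 => fun v =>
      a t' * gossip (jacobi_y t') v + b t' * jacobi_y t' v - c t' * jacobi_y s v
  | 1 => fun v => a 0 * gossip xi v + b 0 * xi v
  end.

Fixpoint jacobi_delta (t : nat) : R :=
  match t with
  | 0 => 1
  | (s.+1 as t').+1 =>
      (a t' + b t') * jacobi_delta t' - c t' * jacobi_delta s
  | 1 => a 0 + b 0
  end.

Definition jacobi_x (t : nat) : V -> R :=
  fun v => jacobi_y t v / jacobi_delta t.

End Iteration.

Definition average (R : realType) (V : finType) (xi : V -> R) : R :=
  (#|V|%:R)^-1 * \sum_v xi v.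

Definition l2norm (R : realType) (V : finType) (x : V -> R) : R :=
  Num.sqrt (\sum_v x v ^+ 2).

(* Main.v *)
Require Import Defs.
From HB Require Import structures.
From mathcomp Require Import all_boot all_order all_algebra.
From mathcomp Require Import polyrcf complex.
From mathcomp Require Import all_classical all_reals all_analysis.
From mathcomp Require Import ring lra.
Set Implicit Arguments.
Unset Strict Implicit.
Unset Printing Implicit Defensive.
Import Order.TTheory GRing.Theory Num.Theory.
Import numFieldNormedType.Exports.
Local Open Scope classical_set_scope.
Local Open Scope ring_scope.

(* Diagonalising the symmetric matrix W turns the vector recurrence of
   y^t - delta_t xibar 1 into scalar recurrences
     p_{t+2} = A_t p_{t+1} - c_t p_t,  A_t -> 2 mu,  c_t -> 1,
   where mu = (lambda + gamma/2) / (1 - gamma/2). The eigenvalues relevant on the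
   orthogonal of 1 lie in [-1, 1 - gamma], so |mu| <= 1 and p_t grows
   subexponentially, because the quadratic form X^2 - 2 mu X Y + Y^2 is invariant
   under the limiting recurrence. The normalisation delta_t solves the recurrence
   for lambda = 1, where mu > 1; its ratios stay >= 1 and hence are attracted to
   the larger root rho = (1 + sqrt(gamma/2))^2 / (1 - gamma/2) of
   X^2 - 2 mu X + 1. *)

(** * Spectral decomposition *)

(** The complexification of [A] is Hermitian, so it is unitarily diagonalisable with real
    eigenvalues. Injectivity of the embedding of [R] brings the characteristic polynomial back to
    [R]; the eigenbasis stays complex. *)
Lemma real_symmetric_spectral (R : rcfType) n (A : 'M[R]_n) : A^T = A ->
  exists (lam : 'I_n -> R) (U : 'M[R[i]]_n),
    [/\ char_poly A = \prod_i ('X - (lam i)%:P),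
        map_mx Num.conj U^T *m U = 1%:M &
        forall i, row i U *m map_mx (real_complex R) A = (lam i)%:C%C *: row i U].
Proof.
move=> Asym; set B := map_mx (real_complex R) A.
have Bherm : B \is hermsymmx.
  apply: realsym_hermsym.
    apply/is_hermitianmxP; rewrite expr0 scale1r map_mx_id // /B.
    by rewrite -{1}Asym map_trmx.
  by apply/mxOverP => i j; rewrite mxE; apply/complex_realP; exists (A i j).
have Breal := hermitian_spectral_diag_real Bherm.
have /orthomx_spectralP := hermitian_normalmx Bherm.
set U := spectralmx B; set D := spectral_diag B => BE.
have Uu : U \in unitmx by exact: spectral_unit.
pose lam i := complex.Re (D 0 i).
have DE i : D 0 i = (lam i)%:C%C by rewrite /lam RRe_real //; exact: (mxOverP Breal).
have UB : U *m B = diag_mx D *m U by rewrite {1}BE !mulmxA mulmxV // mul1mx.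
exists lam, U; split.
- apply: (@map_poly_inj _ _ (real_complex R)).
  rewrite map_char_poly rmorph_prod /= -/B.
  transitivity (char_poly (diag_mx D)).
    have MX (M N : 'M[R[i]]_n) : map_mx (@polyC R[i]) (M *m N) =
        map_mx (@polyC _) M *m map_mx (@polyC _) N.
      exact: map_mxM.
    (* Taking determinants in this intertwining relation and cancelling [\det U] avoids inverting
       [U] over polynomials. *)
    have UX : map_mx (@polyC _) U *m char_poly_mx B =
        char_poly_mx (diag_mx D) *m map_mx (@polyC _) U.
      by rewrite /char_poly_mx mulmxBr mulmxBl -!MX UB scalar_mxC.
    have /(congr1 determinant) := UX.
    rewrite !det_mulmx mulrC => /mulIf; apply.
    by rewrite det_map_mx polyC_eq0 -unitfE.
  rewrite char_poly_trig; last first.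
    by apply: diag_mx_is_trig.
  by apply: eq_bigr => i _; rewrite rmorphB /= map_polyX map_polyC /= -DE mxE eqxx mulr1n.
- by rewrite -invmx_unitary ?spectral_unitarymx // mulVmx.
- by move=> i; rewrite -row_mul UB row_mul row_diag_mx -scalemxAl -rowE DE.
Qed.

(** Since [rootsR] has no duplicates, only one block of the flattened list can contain [x], and its
    length is the multiplicity of [x]. *)
Lemma eigenvalues_perm (R : realType) n (A : 'M[R]_n) (s : seq R) :
  char_poly A = \prod_(x <- s) ('X - x%:P) -> perm_eq (eigenvalues A) s.
Proof.
move=> pE; have p0 : char_poly A != 0 by rewrite monic_neq0 // char_poly_monic.
apply/allP => x _ /=; apply/eqP.
have mE y : mup y (char_poly A) = count_mem y s by rewrite pE mu_prod_XsubC.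
rewrite /eigenvalues -mE.
have : uniq (rev (rootsR (char_poly A))).
  rewrite rev_uniq; apply: sorted_uniq (sorted_roots _ _ _); [exact: lt_trans | exact: ltxx].
have : (x \in rev (rootsR (char_poly A))) = (0 < mup x (char_poly A))%N.
  by rewrite mem_rev -roots_on_rootsR // -XsubC_dvd // dvdp_XsubCl.
elim: (rev _) => [|y l IH] /=; first by rewrite in_nil; case: mup.
rewrite in_cons count_cat count_nseq /= => xm /andP[yl ul].
have [xy|xy] := eqVneq x y.
  rewrite mul1n -xy; apply/eqP; rewrite -[X in _ == X]addn0 eqn_add2l; apply/eqP/count_memPn.
  apply: contra yl; rewrite -xy => /flattenP[_ /mapP[z zl ->]].
  by rewrite mem_nseq => /andP[_ /eqP ->].
rewrite mul0n add0n; apply: IH => //.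
by rewrite -xm (negPf xy).
Qed.

Lemma eigenvalues_sorted (R : realType) n (A : 'M[R]_n) :
  sorted >=%R (eigenvalues A).
Proof.
have p0 : char_poly A != 0 by rewrite monic_neq0 // char_poly_monic.
rewrite /eigenvalues.
have : sorted >%R (rev (rootsR (char_poly A))) by rewrite rev_sorted; exact: sorted_roots.
elim: (rev _) => [//|y l IH] /= yl.
have /IH {}IH := path_sorted yl.
have ly : all (<= y) (flatten [seq nseq (mup x (char_poly A)) x | x <- l]).
  apply/allP => z /flattenP[_ /mapP[w wl ->]]; rewrite mem_nseq => /andP[_ /eqP ->].
  by have /allP/(_ w wl)/ltW := order_path_min (rev_trans lt_trans) yl.
elim: (mup y _) => [//|k IHk] /=.
rewrite path_min_sorted //; apply/allP => z; rewrite mem_cat mem_nseq => /orP[/andP[_ /eqP ->]|zl].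
  exact: lexx.
exact: (allP ly).
Qed.

(** Distinct indices, not distinct values, are required, so multiplicity counts: at least two
    entries of the sorted list exceed [x]. This links the position in the list used by
    [spectral_gap] to indexed eigenvalues. *)
Lemma second_eigenvalue_gt (R : realType) n (A : 'M[R]_n) (lam : 'I_n -> R) x x0 i j :
    char_poly A = \prod_i ('X - (lam i)%:P) -> i != j ->
    x < lam i -> x < lam j -> x < nth x0 (eigenvalues A) 1.
Proof.
move=> pE ij xi xj.
have pm : perm_eq (eigenvalues A) [seq lam k | k <- enum 'I_n].
  by apply: eigenvalues_perm; rewrite pE big_map big_enum.
have cnt : (2 <= count (> x)%R (eigenvalues A))%N.
  rewrite (permP pm) count_map.
  have -> : count (preim lam (> x)) (enum 'I_n) = #|[pred k | x < lam k]|.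
    by rewrite cardE /enum_mem size_filter count_filter; apply: eq_count => k; rewrite /= andbT.
  have <- : #|[set i; j]%SET| = 2%N by rewrite cards2 ij.
  by apply/subset_leq_card/fintype.subsetP => k /set2P[] ->; rewrite inE.
move: cnt (eigenvalues_sorted A).
case: (eigenvalues A) => [//|a [|b s]] /=; first by case: (_ < _).
move=> cnt /andP[_ bs]; rewrite ltNge; apply/negP => bx.
have : count (> x) s = 0%N.
  apply/eqP; rewrite -leqn0 leqNgt -has_count; apply/hasPn => z zs /=.
  have /allP/(_ z zs) := order_path_min (rev_trans le_trans) bs.
  by rewrite -leNgt => zb; apply: le_trans bx.
by move=> c0; move: cnt; rewrite c0 addn0 (ltNge x b) bx; case: (_ < _).
Qed.

Lemma sum_stochastic_mul (R : realType) (V : finType) (e : rel V) (W : V -> V -> R)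
    (f : V -> R) : gossip_matrix e W -> \sum_v \sum_w f v * W v w = \sum_v f v.
Proof.
by move=> hW; apply: eq_bigr => v _; rewrite -big_distrr /= (gossip_stochastic hW) mulr1.
Qed.

(** The sum of the nonnegative terms [W v w * (f v + f w) ^+ 2] equals [2 * (1 + lam)] times the
    squared norm of [f]. *)
Lemma gossip_eigenvalue_geN1 (R : realType) (V : finType) (e : rel V)
    (W : V -> V -> R) (lam : R) (f : V -> R) :
    gossip_matrix e W -> (forall w, \sum_v f v * W v w = lam * f w) ->
    0 < \sum_v f v ^+ 2 -> -1 <= lam.
Proof.
move=> hW hf f0.
have h : 0 <= \sum_v \sum_w W v w * (f v + f w) ^+ 2.
  by apply: sumr_ge0 => v _; apply: sumr_ge0 => w _; rewrite mulr_ge0 ?sqr_ge0 ?(gossip_ge0 hW).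
have s1 : \sum_v \sum_w f v ^+ 2 * W v w = \sum_v f v ^+ 2.
  exact: sum_stochastic_mul hW.
have s2 : \sum_v \sum_w f w ^+ 2 * W v w = \sum_v f v ^+ 2.
  rewrite exchange_big -[RHS]s1; apply: eq_bigr => v _; apply: eq_bigr => w _ /=.
  by rewrite (gossip_symmetric hW).
have s3 : \sum_v \sum_w f v * W v w * f w = lam * \sum_v f v ^+ 2.
  rewrite exchange_big big_distrr; apply: eq_bigr => w _ /=.
  by rewrite -big_distrl /= hf expr2 mulrA.
have : \sum_v \sum_w W v w * (f v + f w) ^+ 2 = 2 * (1 + lam) * \sum_v f v ^+ 2.
  transitivity (\sum_v f v ^+ 2 + \sum_v f v ^+ 2 + 2 * (lam * \sum_v f v ^+ 2)); last by ring.
  rewrite -{1}s1 -{1}s2 -s3 big_distrr -!big_split; apply: eq_bigr => v _ /=.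
  by rewrite big_distrr -!big_split; apply: eq_bigr => w _ /=; ring.
move=> hE; move: h; rewrite hE pmulr_lge0 // pmulr_rge0 //; lra.
Qed.

Lemma complex_Re_mulr (R : rcfType) (z : R[i]) (a : R) :
  complex.Re (z * a%:C%C) = complex.Re z * a.
Proof. by case: z => x y /=; ring. Qed.

Lemma complex_Im_mulr (R : rcfType) (z : R[i]) (a : R) :
  complex.Im (z * a%:C%C) = complex.Im z * a.
Proof. by case: z => x y /=; ring. Qed.

(* The forms [L i] are the real and imaginary parts of a unitary eigenbasis, so each
   eigenvalue occurs twice. *)
Lemma gossip_spectral (R : realType) (V : finType) (e : rel V)
    (W : V -> V -> R) (gamma : R) :
    gossip_matrix e W -> 0 < gamma -> gamma <= spectral_gap W ->
  exists (I : finType) (lam : I -> R) (L : I -> V -> R),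
  [/\ forall x : V -> R, \sum_v x v ^+ 2 = \sum_i (\sum_v L i v * x v) ^+ 2,
      forall i w, \sum_v L i v * W v w = lam i * L i w &
      forall i, -1 <= lam i <= 1 - gamma \/
        forall x : V -> R, \sum_v x v = 0 -> \sum_v L i v * x v = 0].
Proof.
move=> hW g0 gap.
have Msym : (matrix_of W)^T = matrix_of W.
  by apply/matrixP => i j; rewrite !mxE (gossip_symmetric hW).
have [lam [U [pE UU UM]]] := real_symmetric_spectral Msym.
pose u i v := U i (enum_rank v).
have sumV (T : nmodType) (F : V -> T) : \sum_v F v = \sum_i F (@enum_val V V i).
  exact: (reindex _ (onW_bij _ (enum_val_bij V))).
have F1 v w : \sum_i Num.conj (u i v) * u i w = (v == w)%:R.
  have /matrixP/(_ (enum_rank v) (enum_rank w)) := UU.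
  rewrite !mxE (inj_eq enum_rank_inj) => <-.
  by apply: eq_bigr => i _; rewrite !mxE.
have F2 i w : \sum_v u i v * (W v w)%:C%C = (lam i)%:C%C * u i w.
  have /rowP/(_ (enum_rank w)) := UM i.
  rewrite !mxE sumV => <-.
  by apply: eq_bigr => k _; rewrite !mxE /u enum_valK enum_rankK.
have conjR (a : R) : Num.conj a%:C%C = a%:C%C by apply/conj_Creal/complex_realP; exists a.
pose c i (x : V -> R) := \sum_v u i v * (x v)%:C%C.
(* Parseval's identity, from the orthonormality of the columns of [U] in [F1]. *)
have F3 (x y : V -> R) : (\sum_v x v * y v)%:C%C = \sum_i Num.conj (c i x) * c i y.
  transitivity (\sum_i \sum_v \sum_w Num.conj (u i v) * u i w * ((x v)%:C%C * (y w)%:C%C)).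
    rewrite exchange_big rmorph_sum /=; apply: eq_bigr => v _.
    rewrite exchange_big (bigD1 v) //= [X in _ + X]big1 ?addr0.
      by rewrite -big_distrl /= F1 eqxx mul1r rmorphM.
    by move=> w wv; rewrite -big_distrl /= F1 eq_sym (negPf wv) mul0r.
  apply: eq_bigr => i _; rewrite /c rmorph_sum big_distrl /=; apply: eq_bigr => v _.
  rewrite big_distrr; apply: eq_bigr => w _ /=.
  rewrite rmorphM /= conjR; ring.
pose L (k : 'I_#|V| * bool) v := if k.2 then complex.Re (u k.1 v) else complex.Im (u k.1 v).
have LE i b x : \sum_v L (i, b) v * x v = if b then complex.Re (c i x) else complex.Im (c i x).
  case: b; rewrite /c raddf_sum; apply: eq_bigr => v _ /=.
    by rewrite complex_Re_mulr.
  by rewrite complex_Im_mulr.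
exists _, (fun k : 'I_#|V| * bool => lam k.1), L; split.
- move=> x; apply: (@complexI R).
  transitivity (\sum_v x v * x v)%:C%C; first by congr (_%:C)%C; apply: eq_bigr => v _.
  rewrite F3 -(pair_bigA _ (fun i b => (\sum_v L (i, b) v * x v) ^+ 2)) rmorph_sum /=.
  apply: eq_bigr => i _; rewrite big_bool /= !LE -/(c i x) mulrC.
  by rewrite add_Re2_Im2 normCK.
- move=> [i b] w /=; have h := F2 i w.
  have := LE i b (fun v => W v w); rewrite /c h /L => ->.
  by case: b => /=; rewrite mulrC (complex_Re_mulr, complex_Im_mulr) mulrC.
move=> [i b] /=.
have [|lami] := leP (lam i) (1 - gamma); last first.
  right => x x0.
  (* All other eigenvalues are < 1, so the vector 1 has only an i-th coordinate
     and the i-th coordinate of x is proportional to its mean. *)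
  have c1 j : j != i -> c j (fun=> 1) = 0.
    move=> ji.
    (* Two indices above [1 - gamma] would put the second largest eigenvalue above [1 - gamma],
       against the gap. *)
    have lamj : lam j <= 1 - gamma.
      rewrite leNgt; apply/negP => lamj.
      have := second_eigenvalue_gt (-1) pE ji lamj lami.
      by move: gap; rewrite /spectral_gap; lra.
    have lj1 : (1 - lam j)%:C%C != 0 by rewrite (inj_eq (@complexI R) _ 0) subr_eq0 gt_eqF //; lra.
    apply/eqP; rewrite -(mulrI_eq0 _ (mulfI lj1)); apply/eqP.
    rewrite rmorphB /= mulrBl mul1r; apply/eqP; rewrite subr_eq0; apply/eqP.
    rewrite {2}/c big_distrr /=.
    under [RHS]eq_bigr do rewrite mulrA -F2 mulr1.
    rewrite exchange_big; apply: eq_bigr => v _ /=.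
    by rewrite -big_distrr /= -rmorph_sum (gossip_stochastic hW).
  have sumE y : (\sum_v y v)%:C%C = Num.conj (c i (fun=> 1)) * c i y.
    transitivity (\sum_v 1 * y v)%:C%C.
      by congr (_%:C)%C; apply: eq_bigr => v _; rewrite mul1r.
    by rewrite F3 (bigD1 i) //= big1 ?addr0 // => j ji; rewrite c1 // rmorph0 mul0r.
  (* Otherwise the squared norm [#|V|] of the all-ones vector would be 0, while the index [i] shows
     that it is positive. *)
  have : Num.conj (c i (fun=> 1)) != 0.
    apply/eqP => c0; have := sumE (fun=> 1); rewrite c0 mul0r => /(@complexI R _ 0).
    rewrite sumr_const => /eqP; rewrite pnatr_eq0 => /eqP V0.
    by case: (i) => k; rewrite [X in (_ < X)%N]V0.
  move=> c0; have := sumE x; rewrite x0 => /esym/eqP; rewrite mulf_eq0 (negPf c0) /= => /eqP cx.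
  by rewrite LE cx; case: b.
(* The real or imaginary part of an eigenvector may vanish; such a form falls under the second
   alternative. A nonzero one is a real eigenvector, which gives the bound -1. *)
move=> _; have [L0|L0] := eqVneq (\sum_v L (i, b) v ^+ 2) 0.
  right => x _; apply: big1 => v _.
  have /eqP := L0; rewrite psumr_eq0 => [/allP/(_ v (mem_index_enum _))|k _]; last exact: sqr_ge0.
  by rewrite sqrf_eq0 => /eqP ->; rewrite mul0r.
left; rewrite andbT.
apply: (gossip_eigenvalue_geN1 hW (f := L (i, b))).
  move=> w; have := LE i b (fun v => W v w); rewrite /c F2 /L => ->.
  by case: b L0 => _ /=; rewrite mulrC (complex_Re_mulr, complex_Im_mulr) mulrC.
by rewrite lt_neqAle eq_sym L0 sumr_ge0 // => v _; exact: sqr_ge0.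
Qed.

(** * Perturbed three-term recurrences *)

(* The term b^2 v^2 makes the form definite also when mu = 1 or mu = -1. *)
Definition energy (R : realFieldType) (mu b u v : R) : R :=
  u ^+ 2 - 2 * mu * u * v + (1 + b ^+ 2) * v ^+ 2.

(** For [h = 0] the part without [b ^+ 2] is exactly preserved. Three errors remain: replacing
    [b ^+ 2 * y ^+ 2] by [b ^+ 2 * x ^+ 2], the cross term in [h], and [h ^+ 2]. They cost at most
    2, 7 and 6 times [b * energy mu b x y], hence the constant 15. *)
Lemma energy_step (R : realFieldType) (mu b x y h : R) :
    `|mu| <= 1 -> 0 < b <= 1 -> h ^+ 2 <= 2 * b ^+ 4 * (x ^+ 2 + y ^+ 2) ->
  energy mu b (2 * mu * x - y + h) x <= (1 + 15 * b) * energy mu b x y.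
Proof.
move=> mu1 /andP[b0 b1] hh; set E := energy mu b.
have m2 : 0 <= (1 - mu ^+ 2).
  by rewrite subr_ge0 -real_normK ?num_real // exprn_ile1.
pose G (u v : R) := u ^+ 2 - 2 * mu * u * v + v ^+ 2.
have GE u v : E u v = G u v + b ^+ 2 * v ^+ 2 by rewrite /E /energy /G; ring.
have G1 : (x - mu * y) ^+ 2 <= G x y.
  rewrite -subr_ge0.
  have -> : G x y - (x - mu * y) ^+ 2 = (1 - mu ^+ 2) * y ^+ 2 by rewrite /G; ring.
  by rewrite mulr_ge0 ?sqr_ge0.
have G2 : (mu * x - y) ^+ 2 <= G x y.
  rewrite -subr_ge0.
  have -> : G x y - (mu * x - y) ^+ 2 = (1 - mu ^+ 2) * x ^+ 2 by rewrite /G; ring.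
  by rewrite mulr_ge0 ?sqr_ge0.
set w := x - mu * y in G1.
have G0 : 0 <= G x y by apply: le_trans G1; exact: sqr_ge0.
have muy : (mu * y) ^+ 2 <= y ^+ 2.
  rewrite -subr_ge0.
  have -> : y ^+ 2 - (mu * y) ^+ 2 = (1 - mu ^+ 2) * y ^+ 2 by ring.
  by rewrite mulr_ge0 ?sqr_ge0.
have xE : x = mu * y + w by rewrite /w; ring.
have bG : 0 <= b * G x y by rewrite mulr_ge0 // ltW.
have by2 : 0 <= b ^+ 2 * y ^+ 2 by rewrite mulr_ge0 ?sqr_ge0.
have E0 : 0 <= E x y by rewrite GE addr_ge0.
have bx : b ^+ 2 * x ^+ 2 <= b ^+ 2 * y ^+ 2 + 2 * b * E x y.
  (* The extra weight [b] splits the mixed term of [x = mu * y + w] into pieces of order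
     [b * E x y]. *)
  have amgm : 0 <= b * (b * (mu * y) - w) ^+ 2 by rewrite mulr_ge0 ?sqr_ge0 // ltW.
  have e1 : b ^+ 2 * x ^+ 2 = b ^+ 2 * (mu * y) ^+ 2 + 2 * b ^+ 2 * (mu * y) * w + b ^+ 2 * w ^+ 2.
    by rewrite {1}xE; ring.
  have e2 : b ^+ 2 * (mu * y) ^+ 2 <= b ^+ 2 * y ^+ 2 by rewrite ler_wpM2l ?sqr_ge0.
  have e3 : b ^+ 2 * w ^+ 2 <= b * G x y.
    rewrite expr2 -mulrA ler_wpM2l ?(ltW b0) //.
    apply: le_trans G1; rewrite ler_piMl ?sqr_ge0 //.
  have e4 : 2 * b ^+ 2 * (mu * y) * w <= b * (b ^+ 2 * y ^+ 2) + b * G x y.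
    have a1 : b * (b ^+ 2 * (mu * y) ^+ 2) <= b * (b ^+ 2 * y ^+ 2) by rewrite ler_wpM2l // ltW.
    have a2 : b * w ^+ 2 <= b * G x y by rewrite ler_wpM2l // ltW.
    nra.
  have e5 : 2 * b * E x y = 2 * (b * (b ^+ 2 * y ^+ 2)) + 2 * (b * G x y) by rewrite GE; ring.
  have e6 : 0 <= b * (b ^+ 2 * y ^+ 2) by rewrite mulr_ge0 // ltW.
  lra.
have bh : h ^+ 2 <= b ^+ 2 * (6 * E x y).
  apply: le_trans hh _.
  have -> : 2 * b ^+ 4 * (x ^+ 2 + y ^+ 2) =
      b ^+ 2 * (2 * (b ^+ 2 * x ^+ 2 + b ^+ 2 * y ^+ 2)) by ring.
  rewrite ler_wpM2l ?sqr_ge0 //.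
  have e5 : b * E x y <= E x y by rewrite ler_piMl.
  have e6 : b ^+ 2 * x ^+ 2 <= 2 * b ^+ 2 * y ^+ 2 + 2 * G x y.
    have s0 : 0 <= b ^+ 2 * (mu * y - w) ^+ 2 by rewrite mulr_ge0 ?sqr_ge0.
    have e2 : b ^+ 2 * (mu * y) ^+ 2 <= b ^+ 2 * y ^+ 2 by rewrite ler_wpM2l ?sqr_ge0.
    have e3 : b ^+ 2 * w ^+ 2 <= G x y.
      by apply: le_trans G1; rewrite ler_piMl ?sqr_ge0 // exprn_ile1 // ltW.
    have e4 : b ^+ 2 * x ^+ 2 =
        2 * (b ^+ 2 * (mu * y) ^+ 2) + 2 * (b ^+ 2 * w ^+ 2) - b ^+ 2 * (mu * y - w) ^+ 2.
      by rewrite {1}xE; ring.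
    lra.
  rewrite GE in e5 *; lra.
(* After multiplication by [b], the inequality of means bounds this by [h ^+ 2] plus
   [b ^+ 2 * (mu * x - y) ^+ 2], that is, by 6 plus 1 times [b ^+ 2 * E x y]. *)
have cross : 2 * h * (mu * x - y) <= 7 * b * E x y.
  rewrite -(ler_pM2l b0).
  have s0 : 0 <= (h - b * (mu * x - y)) ^+ 2 by apply: sqr_ge0.
  have s1 : b ^+ 2 * (mu * x - y) ^+ 2 <= b ^+ 2 * E x y.
    by rewrite ler_wpM2l ?sqr_ge0 // GE; lra.
  have -> : b * (2 * h * (mu * x - y)) =
      h ^+ 2 + b ^+ 2 * (mu * x - y) ^+ 2 - (h - b * (mu * x - y)) ^+ 2 by ring.
  have -> : b * (7 * b * E x y) = b ^+ 2 * (6 * E x y) + b ^+ 2 * E x y by ring.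
  lra.
have -> : E (2 * mu * x - y + h) x = G x y + b ^+ 2 * x ^+ 2 + 2 * h * (mu * x - y) + h ^+ 2.
  by rewrite /E /energy /G; ring.
have bh' : h ^+ 2 <= 6 * b * E x y.
  apply: le_trans bh _; rewrite expr2 -mulrA.
  have -> : 6 * b * E x y = b * (6 * E x y) by ring.
  rewrite ler_wpM2l ?(ltW b0) // ler_piMl // mulr_ge0 //.
have -> : (1 + 15 * b) * E x y = E x y + 15 * b * E x y by ring.
have := GE x y; lra.
Qed.

(** With [b] small in terms of [k], the energy eventually grows by a factor at most [k] per step,
    and it dominates [b ^+ 2 * p t ^+ 2]. *)
Lemma three_term_sqr_bound (R : realType) (mu k : R) (A c p : nat -> R) :
    `|mu| <= 1 -> 1 < k ->
    A @ \oo --> 2 * mu -> c @ \oo --> (1 : R) ->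
    (forall t, p t.+2 = A t * p t.+1 - c t * p t) ->
  exists C, \forall t \near \oo, p t ^+ 2 <= C * k ^+ t.
Proof.
move=> mu1 k1 Acv ccv prec.
pose b := Num.min 1 ((k - 1) / 15).
have b0 : 0 < b by rewrite lt_min ltr01 divr_gt0 // subr_gt0.
have b1 : b <= 1 by rewrite ge_min lexx.
have bk : 1 + 15 * b <= k.
  have : b <= (k - 1) / 15 by rewrite ge_min lexx orbT.
  lra.
pose E := energy mu b.
have Ege u v : b ^+ 2 * v ^+ 2 <= E u v.
  rewrite -subr_ge0.
  have -> : E u v - b ^+ 2 * v ^+ 2 = (u - mu * v) ^+ 2 + (1 - mu ^+ 2) * v ^+ 2.
    by rewrite /E /energy; ring.
  apply: addr_ge0; first exact: sqr_ge0.
  apply: mulr_ge0; last exact: sqr_ge0.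
  by rewrite subr_ge0 -real_normK ?num_real // exprn_ile1.
have b2 : 0 < b ^+ 2 by rewrite exprn_gt0.
have E0 u v : 0 <= E u v.
  by apply: le_trans (Ege u v); rewrite mulr_ge0 ?sqr_ge0 // ltW.
(* The tolerance [b ^+ 2] on both coefficients yields the bound on [h ^+ 2] that [energy_step] asks
   for. *)
have [T _ HT] : \forall t \near \oo, `|2 * mu - A t| <= b ^+ 2 /\ `|1 - c t| <= b ^+ 2.
  near=> t; split; near: t.
  - by move/cvgrPdist_le : Acv; exact.
  - by move/cvgrPdist_le : ccv; exact.
have step t : (T <= t)%N -> E (p t.+2) (p t.+1) <= k * E (p t.+1) (p t).
  move=> Tt; have [hA hc] := HT t Tt.
  pose h := (A t - 2 * mu) * p t.+1 - (c t - 1) * p t.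
  have -> : p t.+2 = 2 * mu * p t.+1 - p t + h by rewrite prec /h; ring.
  apply: le_trans (_ : (1 + 15 * b) * E (p t.+1) (p t) <= _); last by rewrite ler_wpM2r.
  apply: energy_step => //; first by rewrite b0.
  have sqA : (A t - 2 * mu) ^+ 2 <= b ^+ 4.
    by rewrite -[4%N]/(2 * 2)%N exprM -real_normK ?num_real // distrC lerXn2r ?nnegrE // ltW.
  have sqc : (c t - 1) ^+ 2 <= b ^+ 4.
    by rewrite -[4%N]/(2 * 2)%N exprM -real_normK ?num_real // distrC lerXn2r ?nnegrE // ltW.
  have s0 : 0 <= ((A t - 2 * mu) * p t.+1 + (c t - 1) * p t) ^+ 2 by apply: sqr_ge0.
  have e1 : (A t - 2 * mu) ^+ 2 * p t.+1 ^+ 2 <= b ^+ 4 * p t.+1 ^+ 2 by rewrite ler_wpM2r ?sqr_ge0.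
  have e2 : (c t - 1) ^+ 2 * p t ^+ 2 <= b ^+ 4 * p t ^+ 2 by rewrite ler_wpM2r ?sqr_ge0.
  have -> : h ^+ 2 = 2 * ((A t - 2 * mu) ^+ 2 * p t.+1 ^+ 2) + 2 * ((c t - 1) ^+ 2 * p t ^+ 2)
      - ((A t - 2 * mu) * p t.+1 + (c t - 1) * p t) ^+ 2 by rewrite /h; ring.
  lra.
have k0 : 0 < k by apply: lt_trans k1.
have iterE j : E (p (T + j).+1) (p (T + j)%N) <= k ^+ j * E (p T.+1) (p T).
  elim: j => [|j IH]; first by rewrite addn0 expr0 mul1r.
  rewrite addnS exprS -mulrA; apply: le_trans (step _ (leq_addr _ _)) _.
  by rewrite ler_pM2l.
exists (E (p T.+1) (p T) / (b ^+ 2 * k ^+ T)).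
exists T => // t /= Tt.
rewrite -(subnKC Tt); set j := (t - T)%N.
rewrite -(ler_pM2l b2); apply: le_trans (Ege _ _) _; apply: le_trans (iterE j) _.
rewrite exprD le_eqVlt; apply/orP; left; apply/eqP; field.
by rewrite !expf_neq0 ?gt_eqF.
Unshelve. all: by end_near.
Qed.

(** The limiting map on ratios, x to [rho + rho^-1 - x^-1], repels from [rho^-1] and attracts to
    [rho]. Monotonicity of [D] keeps the ratios at least 1, away from the repelling point, so they
    eventually exceed [r]. *)
Lemma three_term_growth (R : realType) (rho r : R) (A c D : nat -> R) :
    0 < r -> r < rho -> 1 < rho ->
    A @ \oo --> rho + rho^-1 -> c @ \oo --> (1 : R) ->
    D 0 = 1 -> (forall t, D t <= D t.+1) ->
    (forall t, D t.+2 = A t * D t.+1 - c t * D t) ->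
  exists2 C, 0 < C & \forall t \near \oo, C * r ^+ t <= D t.
Proof.
move=> r0 rrho rho1 Acv ccv D0 Dinc Drec.
have Dgt0 t : 0 < D t by elim: t => [|t IH]; rewrite ?D0 //; apply: lt_le_trans (Dinc t).
have rho0 : 0 < rho by apply: lt_trans rho1.
pose q := rho^-1.
have q0 : 0 < q by rewrite invr_gt0.
have q1 : q < 1 by rewrite invf_lt1.
(* Errors [2 * eta] under contraction by [q] accumulate to [2 * eta / (1 - q) = (rho - r) / 2]; the
   other half of [rho - r] is left for the transient [M * q ^+ j]. *)
pose eta := (rho - r) * (1 - q) / 4.
have eta0 : 0 < eta by rewrite divr_gt0 // mulr_gt0 ?subr_gt0.
pose x t := D t.+1 / D t.
have x1 t : 1 <= x t by rewrite ler_pdivlMr // mul1r.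
have [T _ HT] : \forall t \near \oo, `|rho + q - A t| <= eta /\ `|1 - c t| <= eta.
  near=> t; split; near: t.
  - by move/cvgrPdist_le : Acv; exact.
  - by move/cvgrPdist_le : ccv; exact.
(* The ratios obey x (t + 1) = A t - c t / x t, and a defect rho - x t is
   contracted by 1 / (rho x t) <= q. *)
pose M := Num.max 0 (rho - x T).
have M0 : 0 <= M by rewrite le_max lexx.
(* Only a lower bound on the ratios is needed, so the positive part of the defect is tracked;
   [1 <= x t] then allows dropping the division by [x t]. *)
have step t : (T <= t)%N -> rho - x t.+1 <= Num.max 0 (rho - x t) * q + 2 * eta.
  move=> Tt; have [hA hc] := HT t Tt.
  have xt0 : 0 < x t by apply: lt_le_trans (x1 t).
  have xS : x t.+1 = A t - c t / x t.
    rewrite /x Drec; field; by rewrite !gt_eqF.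
  have -> : rho - x t.+1 = (rho + q - A t) - (1 - c t) / x t + (rho - x t) * q / x t.
    by rewrite xS /q; field; rewrite !gt_eqF.
  have h1 : rho + q - A t <= eta by apply: le_trans hA; exact: ler_norm.
  have h2 : - ((1 - c t) / x t) <= eta.
    apply: le_trans (_ : `|(1 - c t) / x t| <= _); first by rewrite lerNl lerNnormlW.
    rewrite normrM normfV (gtr0_norm xt0) ler_pdivrMr //.
    by apply: le_trans hc _; rewrite ler_peMr // ltW.
  have h3 : (rho - x t) * q / x t <= Num.max 0 (rho - x t) * q.
    rewrite ler_pdivrMr //.
    apply: le_trans (_ : Num.max 0 (rho - x t) * q <= _).
      by rewrite ler_pM2r // le_max lexx orbT.
    by rewrite ler_peMr // mulr_ge0 ?le_max ?lexx // ltW.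
  lra.
have dec j : Num.max 0 (rho - x (T + j)%N) <= M * q ^+ j + (rho - r) / 2.
  elim: j => [|j IH].
    by rewrite addn0 expr0 mulr1 lerDl divr_ge0 // subr_ge0 ltW.
  rewrite addnS ge_max; apply/andP; split.
    by rewrite addr_ge0 ?mulr_ge0 ?exprn_ge0 ?divr_ge0 ?subr_ge0 // ?(ltW q0) ?(ltW rrho).
  apply: le_trans (step _ (leq_addr _ _)) _.
  apply: le_trans (_ : (M * q ^+ j + (rho - r) / 2) * q + 2 * eta <= _).
    by rewrite lerD2r ler_pM2r.
  by rewrite exprS /eta le_eqVlt; apply/orP; left; apply/eqP; field.
have qcv : (fun j => M * q ^+ j) @ \oo --> (0 : R).
  rewrite -[0](mulr0 M); apply: cvgM; first exact: cvg_cst.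
  by apply: cvg_expr; rewrite gtr0_norm.
have rr2 : 0 < (rho - r) / 2 by rewrite divr_gt0 // subr_gt0.
have [J _ HJ] : \forall j \near \oo, M * q ^+ j <= (rho - r) / 2.
  move/cvgrPdist_le : qcv => /(_ _ rr2); apply: filterS => j.
  by rewrite sub0r normrN; apply: le_trans; exact: ler_norm.
have xr j : (T + J <= j)%N -> r <= x j.
  move=> Tj.
  have := dec (j - T)%N; rewrite subnKC ?(leq_trans _ Tj) ?leq_addr // ge_max => /andP[_ h].
  have h' : M * q ^+ (j - T) <= (rho - r) / 2.
    by apply: HJ; rewrite /= leq_subRL // (leq_trans _ Tj) ?leq_addr.
  lra.
pose S := (T + J)%N.
have grow j : D S * r ^+ j <= D (S + j)%N.
  elim: j => [|j IH]; first by rewrite addn0 expr0 mulr1.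
  rewrite exprSr mulrA addnS.
  apply: le_trans (_ : D (S + j)%N * r <= _); first by rewrite ler_pM2r.
  by rewrite mulrC -ler_pdivlMr // xr // leq_addr.
exists (D S / r ^+ S); first by rewrite divr_gt0 ?exprn_gt0.
exists S => // t /= St.
rewrite -(subnKC St); apply: le_trans (grow _).
by rewrite exprD mulrA divfK ?expf_neq0 ?gt_eqF.
Unshelve. all: by end_near.
Qed.

(** With [r] between [q^-1] and [rho], and [k] between 1 and [(q * r) ^+ 2], the two growth bounds
    dominate the squared quotient by a geometric sequence of ratio [k / (q * r) ^+ 2 < 1]. *)
Lemma three_term_ratio_cvg0 (R : realType) (mu rho q : R) (A A' c p D : nat -> R) :
    `|mu| <= 1 -> 1 < rho -> rho^-1 < q ->
    A @ \oo --> 2 * mu -> A' @ \oo --> rho + rho^-1 -> c @ \oo --> (1 : R) ->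
    (forall t, p t.+2 = A t * p t.+1 - c t * p t) ->
    D 0 = 1 -> (forall t, D t <= D t.+1) ->
    (forall t, D t.+2 = A' t * D t.+1 - c t * D t) ->
  (fun t => (p t / D t / q ^+ t) ^+ 2) @ \oo --> (0 : R).
Proof.
move=> mu1 rho1 qrho Acv A'cv ccv prec D0 Dinc Drec.
have Dgt0 t : 0 < D t by elim: t => [|t IH]; rewrite ?D0 //; apply: lt_le_trans (Dinc t).
have rho0 : 0 < rho by apply: lt_trans rho1.
have q0 : 0 < q by apply: lt_trans qrho; rewrite invr_gt0.
have qr : q^-1 < rho by rewrite invf_plt.
pose r := (q^-1 + rho) / 2.
have r0 : 0 < r by rewrite divr_gt0 // addr_gt0 // invr_gt0.
have rr : r < rho by rewrite /r; lra.
have qr1 : 1 < q * r.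
  have h : q^-1 < r by rewrite /r; lra.
  by rewrite -(ltr_pM2l q0) mulfV ?gt_eqF // in h.
have qr2 : 1 < (q * r) ^+ 2 by rewrite exprn_egt1.
pose k := (1 + (q * r) ^+ 2) / 2.
have k1 : 1 < k by rewrite /k; lra.
have kq : k < (q * r) ^+ 2 by rewrite /k; lra.
have [C HC] := three_term_sqr_bound mu1 k1 Acv ccv prec.
have [C' C'0 HC'] := three_term_growth r0 rr rho1 A'cv ccv D0 Dinc Drec.
pose s := k / (q * r) ^+ 2.
have s1 : `|s| < 1.
  rewrite gtr0_norm; first by rewrite ltr_pdivrMr ?mul1r // (lt_trans ltr01).
  by rewrite divr_gt0 // (lt_trans ltr01).
have bcv : (fun t => C / C' ^+ 2 * s ^+ t) @ \oo --> (0 : R).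
  rewrite -[0](mulr0 (C / C' ^+ 2)); apply: cvgM; first exact: cvg_cst.
  exact: cvg_expr.
apply: (squeeze_cvgr _ _ bcv); last exact: (@cvg_cst _ (0 : R)).
near=> t; rewrite sqr_ge0 /=.
have h1 : p t ^+ 2 <= C * k ^+ t by near: t.
have h2 : C' * r ^+ t <= D t by near: t.
rewrite -mulrA -invfM expr_div_n ler_pdivrMr ?exprn_gt0 ?mulr_gt0 ?exprn_gt0 //.
have CC : 0 <= C * k ^+ t by apply: le_trans h1; exact: sqr_ge0.
have C'r : 0 < C' * r ^+ t by rewrite mulr_gt0 ?exprn_gt0.
apply: le_trans h1 _.
have -> : C / C' ^+ 2 * s ^+ t * (D t * q ^+ t) ^+ 2 =
    C * k ^+ t * (D t / (C' * r ^+ t)) ^+ 2.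
  have -> : s ^+ t = k ^+ t / (q ^+ t * r ^+ t) ^+ 2.
    by rewrite /s expr_div_n -!exprMn -!exprM mulnC.
  by field; rewrite !expf_neq0 ?gt_eqF.
by rewrite ler_peMr // exprn_ege1 // ler_pdivlMr // mul1r.
Unshelve. all: by end_near.
Qed.

(** * The Jacobi iteration *)

Section coefficient_limits.
Variables (R : realType) (d : R).
Hypothesis d_gt0 : 0 < d.

(* In the variable 1 / s t, which tends to 0, the coefficients of index t + 1 are
   rational functions without pole at 0. *)
Let s (t : nat) : R := t.+1%:R + 1 + d / 2.
Let s_gt0 t : 0 < s t.
Proof. by rewrite /s !addr_gt0 ?divr_gt0 ?ltr0n. Qed.

Let sV_cvg0 : (fun t => (s t)^-1) @ \oo --> (0 : R).
Proof.
apply: (squeeze_cvgr _ (@cvg_cst _ (0 : R) _ _ _) (@cvg_harmonic R)).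
near=> t; rewrite /= invr_ge0 ltW //= lef_pV2 ?posrE ?s_gt0 ?ltr0n //.
by rewrite /s -addrA lerDl addr_ge0 ?divr_ge0 ?ltW.
Unshelve. all: by end_near.
Qed.

Lemma jacobi_a_cvg : (fun t => jacobi_a d t.+1) @ \oo --> (2 : R).
Proof.
have -> : (fun t => jacobi_a d t.+1) =
    (fun t => (2 - (d / 2 + 1) * (s t)^-1) * (2 - d / 2 * (s t)^-1) / 2).
  apply/funext => t; rewrite /jacobi_a /= -/(s t).
  have -> : t.+1%:R = s t - 1 - d / 2 by rewrite /s; ring.
  by field; rewrite gt_eqF.
rewrite [X in _ --> X](_ : _ = (2 - (d / 2 + 1) * 0) * (2 - d / 2 * 0) / 2); last by field.
apply: cvgM; last exact: cvg_cst.
by apply: cvgM; apply: cvgB; (try exact: cvg_cst); apply: cvgM => //; exact: cvg_cst.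
Qed.

Lemma jacobi_b_cvg : (fun t => jacobi_b d t.+1) @ \oo --> (0 : R).
Proof.
have -> : (fun t => jacobi_b d t.+1) =
    (fun t => d ^+ 2 / 8 * ((2 - (d / 2 + 1) * (s t)^-1) * (s t)^-1 * (s t)^-1 /
      (2 - (d / 2 + 2) * (s t)^-1))).
  apply/funext => t; rewrite /jacobi_b /= -/(s t).
  have h : 0 < 2 * t.+1%:R + d / 2 by rewrite addr_gt0 ?mulr_gt0 ?divr_gt0 ?ltr0n.
  have tE : t.+1%:R = s t - 1 - d / 2 by rewrite /s; ring.
  rewrite tE in h *.
  field; rewrite !gt_eqF //; lra.
rewrite [X in _ --> X](_ : _ =
    d ^+ 2 / 8 * ((2 - (d / 2 + 1) * 0) * 0 * 0 / (2 - (d / 2 + 2) * 0))); last by field.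
apply: cvgM; first exact: cvg_cst.
have lin (x : R) : (fun t => 2 - x * (s t)^-1) @ \oo --> 2 - x * 0.
  by apply: cvgB; (try exact: cvg_cst); apply: cvgM => //; exact: cvg_cst.
apply: cvgM; last by apply: cvgV; [rewrite mulr0 subr0 pnatr_eq0 | exact: lin].
by apply: cvgM => //; apply: cvgM => //; exact: lin.
Qed.

Lemma jacobi_c_cvg : (fun t => jacobi_c d t.+1) @ \oo --> (1 : R).
Proof.
have -> : (fun t => jacobi_c d t.+1) =
    (fun t => (1 - (d / 2 + 1) * (s t)^-1) * (1 - (d / 2 + 1) * (s t)^-1) *
       (2 - d / 2 * (s t)^-1) / (2 - (d / 2 + 2) * (s t)^-1)).
  apply/funext => t; rewrite /jacobi_c /= -/(s t).
  have h : 0 < 2 * t.+1%:R + d / 2 by rewrite addr_gt0 ?mulr_gt0 ?divr_gt0 ?ltr0n.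
  have tE : t.+1%:R = s t - 1 - d / 2 by rewrite /s; ring.
  rewrite tE in h *.
  field; rewrite !gt_eqF //; lra.
rewrite [X in _ --> X](_ : _ =
    (1 - (d / 2 + 1) * 0) * (1 - (d / 2 + 1) * 0) *
      (2 - d / 2 * 0) / (2 - (d / 2 + 2) * 0)); last by field.
have lin (y x : R) : (fun t => y - x * (s t)^-1) @ \oo --> y - x * 0.
  by apply: cvgB; (try exact: cvg_cst); apply: cvgM => //; exact: cvg_cst.
apply: cvgM; last by apply: cvgV; [rewrite mulr0 subr0 pnatr_eq0 | exact: lin].
by do !apply: cvgM; exact: lin.
Qed.

(** With [jacobi_coef_sum], this says that for [gamma = 0] the normalisation is constantly 1. *)
Lemma jacobi_coef_sum0 : jacobi_a d 0 + jacobi_b d 0 = 1.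
Proof. by rewrite /jacobi_a /jacobi_b /=; field; rewrite gt_eqF // addr_gt0. Qed.

Lemma jacobi_coef_sum t : jacobi_a d t.+1 + jacobi_b d t.+1 - jacobi_c d t.+1 = 1.
Proof.
rewrite /jacobi_a /jacobi_b /jacobi_c /=.
have h : 0 < (t.+1%:R : R) by rewrite ltr0n.
move: (t.+1%:R) h => x h.
by field; rewrite !gt_eqF ?addr_gt0 ?mulr_gt0 ?addr_gt0.
Qed.

Lemma jacobi_a_ge0 t : 0 <= jacobi_a d t.
Proof.
have d0 := d_gt0.
have h : 0 <= (t%:R : R) by rewrite ler0n.
rewrite /jacobi_a; case: ifP => _; apply: divr_ge0; rewrite ?mulr_ge0 ?sqr_ge0 //; lra.
Qed.

Lemma jacobi_c_ge0 t : 0 <= jacobi_c d t.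
Proof.
have d0 := d_gt0.
have h : 0 <= (t%:R : R) by rewrite ler0n.
rewrite /jacobi_c; apply: divr_ge0; rewrite ?mulr_ge0 ?sqr_ge0 //; lra.
Qed.

End coefficient_limits.

(** * The mean and the normalising sequence *)

Lemma sum_average (R : realType) (V : finType) (xi : V -> R) :
  \sum_(v : V) average xi = \sum_v xi v.
Proof.
(* For empty [V] the factor in [average] is the inverse of 0, but both sums are empty. *)
have [V0|V0] := eqVneq #|V| 0%N.
  by rewrite !big1 // => v; have := fintype0 v V0.
by rewrite sumr_const -[LHS]mulr_natl /average mulrA mulfV ?mul1r // pnatr_eq0.
Qed.

Lemma jacobi_delta_rec (R : realType) (d gamma : R) t :
  jacobi_delta d gamma t.+2 =
  (gap_a d gamma t.+1 + gap_b d gamma t.+1) * jacobi_delta d gamma t.+1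
  - gap_c d t.+1 * jacobi_delta d gamma t.
Proof. by []. Qed.

(** Each increment is [gap_c] times the previous one plus a nonnegative multiple of the current
    term, coming from [gamma]. *)
Lemma jacobi_delta_nondecreasing (R : realType) (d gamma : R) t :
  0 < d -> 0 <= gamma < 2 ->
  1 <= jacobi_delta d gamma t <= jacobi_delta d gamma t.+1.
Proof.
move=> d0 /andP[g0 g2].
have gE s : gap_a d gamma s + gap_b d gamma s
    = jacobi_a d s + jacobi_b d s + jacobi_a d s * (gamma / (1 - gamma / 2)).
  by rewrite /gap_a /gap_b; field; rewrite subr_eq0 gt_eqF.
have ag s : 0 <= jacobi_a d s * (gamma / (1 - gamma / 2)).
  by rewrite mulr_ge0 ?jacobi_a_ge0 // divr_ge0 //; lra.
elim: t => [|t /andP[D1 DS]].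
  by rewrite lexx /= gE jacobi_coef_sum0 // lerDl.
have D1' := le_trans D1 DS; rewrite D1' andTb.
have cD : gap_c d t.+1 * jacobi_delta d gamma t <= gap_c d t.+1 * jacobi_delta d gamma t.+1.
  by rewrite ler_wpM2l // jacobi_c_ge0.
rewrite jacobi_delta_rec gE; have := jacobi_coef_sum d0 t; rewrite -/(gap_c d t.+1) => h.
have -> : jacobi_a d t.+1 + jacobi_b d t.+1 = 1 + gap_c d t.+1 by rewrite -h; ring.
have : 0 <= jacobi_a d t.+1 * (gamma / (1 - gamma / 2)) * jacobi_delta d gamma t.+1.
  by rewrite mulr_ge0 // (le_trans ler01).
rewrite !mulrDl mul1r; lra.
Qed.

(** The gap correction is the affine change of variable that maps [[-1, 1 - gamma]] onto [[-1, 1]]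
    and sends 1 beyond 1. *)
Lemma gap_coef_cvg (R : realType) (d gamma lam : R) : 0 < d -> gamma < 2 ->
  (fun t => gap_a d gamma t.+1 * lam + gap_b d gamma t.+1) @ \oo -->
    2 * ((lam + gamma / 2) / (1 - gamma / 2)).
Proof.
move=> d0 g2.
have -> : (fun t => gap_a d gamma t.+1 * lam + gap_b d gamma t.+1) =
    (fun t => jacobi_a d t.+1 * ((lam + gamma / 2) / (1 - gamma / 2)) + jacobi_b d t.+1).
  by apply/funext => t; rewrite /gap_a /gap_b; field; rewrite subr_eq0 gt_eqF.
rewrite -[X in _ --> X]addr0; apply: cvgD; last exact: jacobi_b_cvg.
by apply: cvgM; [exact: jacobi_a_cvg | exact: cvg_cst].
Qed.

(** * Deviation from consensus and its eigencoordinates *)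

Section deviation.
Variables (R : realType) (V : finType) (e : rel V) (W : V -> V -> R).
Variables (d gamma : R) (xi : V -> R).
Hypothesis W_gossip : gossip_matrix e W.

(** Dividing by [jacobi_delta] is postponed so that the recurrence stays linear. *)
Definition deviation (t : nat) (v : V) : R :=
  jacobi_y W d gamma xi t v - jacobi_delta d gamma t * average xi.

Lemma deviation_rec t v : deviation t.+2 v =
  gap_a d gamma t.+1 * gossip W (deviation t.+1) v
  + gap_b d gamma t.+1 * deviation t.+1 v - gap_c d t.+1 * deviation t v.
Proof.
have -> : gossip W (deviation t.+1) v =
    gossip W (jacobi_y W d gamma xi t.+1) v - jacobi_delta d gamma t.+1 * average xi.
  rewrite /gossip /deviation; under eq_bigr do rewrite mulrBr.
  by rewrite sumrB -big_distrl /= (gossip_stochastic W_gossip) mul1r.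
rewrite /deviation /=; ring.
Qed.

Lemma sum_gossip (y : V -> R) : \sum_v gossip W y v = \sum_v y v.
Proof.
rewrite exchange_big; apply: eq_bigr => w _ /=.
under eq_bigr do rewrite (gossip_symmetric W_gossip).
by rewrite -big_distrl /= (gossip_stochastic W_gossip) mul1r.
Qed.

(** The columns of [W] also sum to 1, so the total of [jacobi_y] follows the recurrence of
    [jacobi_delta]. *)
Lemma sum_deviation t : \sum_v deviation t v = 0.
Proof.
have sumE k : \sum_v deviation k v =
    \sum_v jacobi_y W d gamma xi k v - jacobi_delta d gamma k * \sum_v xi v.
  by rewrite sumrB -(mulr_sumr _ _ (fun=> average xi)) sum_average.
suff: \sum_v deviation t v = 0 /\ \sum_v deviation t.+1 v = 0 by case.
elim: t => [|t [IH0 IH1]].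
  rewrite !sumE /= mul1r subrr big_split /= -!mulr_sumr sum_gossip; split=> //; ring.
split=> //; under eq_bigr do rewrite deviation_rec.
by rewrite sumrB big_split /= -!big_distrr /= sum_gossip IH0 IH1; ring.
Qed.

Lemma eigenform_deviation_rec (f : V -> R) lam t :
    (forall w, \sum_v f v * W v w = lam * f w) ->
  \sum_v f v * deviation t.+2 v =
  (gap_a d gamma t.+1 * lam + gap_b d gamma t.+1) * (\sum_v f v * deviation t.+1 v)
  - gap_c d t.+1 * (\sum_v f v * deviation t v).
Proof.
move=> hf.
have fW y : \sum_v f v * gossip W y v = lam * \sum_v f v * y v.
  under eq_bigr do rewrite big_distrr /=.
  rewrite exchange_big big_distrr; apply: eq_bigr => w _ /=.
  by under eq_bigr do rewrite mulrA; rewrite -big_distrl /= hf mulrA.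
rewrite mulrDl -[_ * lam * _]mulrA -fW !big_distrr -big_split -sumrB /=.
by apply: eq_bigr => v _; rewrite deviation_rec; ring.
Qed.

End deviation.

(** * From coordinates to the limsup of the norm *)

Lemma limn_esup_le_near (R : realType) (u : (\bar R)^nat) (x : \bar R) :
  (\forall t \near \oo, (u t <= x)%E) -> (limn_esup u <= x)%E.
Proof.
move=> [N _ uN]; rewrite limn_esup_lim; apply: lime_le; first exact: is_cvg_esups.
exists N => // n /= Nn; apply: ge_ereal_sup => _ [k /= nk <-].
by apply: uN; exact: leq_trans nk.
Qed.

Theorem theorem7p1 (R : realType) (V : finType) (e : rel V)
    (W : V -> V -> R) (gamma d : R) (xi : V -> R)
    (e_sym : symmetric e)
    (W_gossip : gossip_matrix e W)
    (gamma_gt0 : 0 < gamma) (gamma_lt2 : gamma < 2)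
    (gamma_gap : gamma <= spectral_gap W)
    (d_gt0 : 0 < d) :
  (limn_esup (fun t : nat =>
     (l2norm (fun v : V => jacobi_x W d gamma xi t v - average xi)
        `^ (t%:R)^-1)%:E)
   <= ((1 - gamma / 2) / (1 + Num.sqrt (gamma / 2)) ^+ 2)%:E)%E.
Proof.
set s := Num.sqrt (gamma / 2).
have s0 : 0 < s by rewrite sqrtr_gt0 divr_gt0.
have s2 : s ^+ 2 = gamma / 2 by rewrite sqr_sqrtr // divr_ge0 // ltW.
have s1 : s < 1 by rewrite -(@expr_lt1 _ 2) // ?ltW // s2; lra.
pose rho := (1 + s) ^+ 2 / (1 - gamma / 2).
(* As [gamma / 2 = s ^+ 2], the denominator factors as [(1 - s) * (1 + s)]. *)
have rhoE : rho = (1 + s) / (1 - s).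
  by rewrite /rho -s2; field; rewrite !gt_eqF //; nra.
have rho1 : 1 < rho by rewrite rhoE ltr_pdivlMr; lra.
have -> : (1 - gamma / 2) / (1 + s) ^+ 2 = rho^-1 by rewrite invf_div.
have [I [lam [L [Pars eig cases]]]] := gossip_spectral W_gossip gamma_gt0 gamma_gap.
apply/lee_addgt0Pr => eps eps0; rewrite -EFinD; set q := rho^-1 + eps.
have qrho : rho^-1 < q by rewrite ltrDl.
have q0 : 0 < q by apply: lt_trans qrho; rewrite invr_gt0 (lt_trans ltr01).
pose D := jacobi_delta d gamma.
pose z := deviation W d gamma xi.
have Dmono t : 1 <= D t <= D t.+1.
  by apply: jacobi_delta_nondecreasing => //; rewrite ltW.
have cvI i : (fun t => ((\sum_v L i v * z t v) / D t / q ^+ t) ^+ 2) @ \oo --> (0 : R).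
  have [/andP[laml lamu]|Li0] := cases i; last first.
    rewrite (_ : (fun _ => _) = (fun=> 0)); first exact: cvg_cst.
    apply/funext => t; rewrite Li0 ?mul0r ?expr0n //.
    exact: sum_deviation W_gossip t.
  have mu1 : `|(lam i + gamma / 2) / (1 - gamma / 2)| <= 1.
    rewrite normrM normfV [`|1 - _|]gtr0_norm ?ler_pdivrMr ?mul1r ?ler_norml; lra.
  (* [D] obeys the same recurrence with the eigenvalue 1 in place of [lam i]. *)
  apply: (@three_term_ratio_cvg0 _ _ _ _ _
    (fun t => gap_a d gamma t.+1 * 1 + gap_b d gamma t.+1) _
    (fun t => \sum_v L i v * z t v) D mu1 rho1 qrho
    (gap_coef_cvg d_gt0 gamma_lt2) _ (jacobi_c_cvg d_gt0)).
  - have -> : rho + rho^-1 = 2 * ((1 + gamma / 2) / (1 - gamma / 2)).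
      rewrite rhoE -s2; field; rewrite !gt_eqF //=; nra.
    exact: (gap_coef_cvg d_gt0 gamma_lt2).
  - by move=> t; apply: eigenform_deviation_rec W_gossip _ _ _ _; exact: eig.
  - by [].
  - by move=> t; have /andP[] := Dmono t.
  - by move=> t; rewrite /D jacobi_delta_rec mulr1.
have cvS : (fun t => \sum_i ((\sum_v L i v * z t v) / D t / q ^+ t) ^+ 2) @ \oo --> (0 : R).
  rewrite [X in _ --> X](_ : _ = \sum_(i : I) 0); last by rewrite big1.
  by apply: cvg_big => [|i _]; [exact: add_continuous | exact: cvI].
apply: limn_esup_le_near.
near=> t; rewrite lee_fin.
(* At [t = 0] the exponent [t^-1] is 0 by convention; taking the root of [q ^+ t] at the end needs
   [t] nonzero. *)
have t0 : (0 < t)%N by near: t; exact: nbhs_infty_gt.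
have D0 : 0 < D t by have /andP[h _] := Dmono t; apply: lt_le_trans h.
(* By Parseval this sum is the squared norm of the error divided by [(q ^+ t) ^+ 2]. *)
have S1 : \sum_i ((\sum_v L i v * z t v) / D t / q ^+ t) ^+ 2 <= 1.
  apply: ltW; near: t.
  by move/cvgr_lt : cvS; apply.
have nq : l2norm (fun v => jacobi_x W d gamma xi t v - average xi) <= q ^+ t.
  rewrite -[leRHS]ger0_norm ?exprn_ge0 ?(ltW q0) // -sqrtr_sqr /l2norm.
  apply: ler_wsqrtr.
  have -> : \sum_v (jacobi_x W d gamma xi t v - average xi) ^+ 2 = \sum_v (z t v) ^+ 2 / D t ^+ 2.
    apply: eq_bigr => v _; rewrite -expr_div_n; congr (_ ^+ 2).
    by rewrite /z /deviation mulrBl [_ * average xi]mulrC mulfK // gt_eqF.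
  rewrite -big_distrl /= Pars ler_pdivrMr ?exprn_gt0 // -exprMn.
  rewrite -[leRHS]mul1r -ler_pdivrMr ?exprn_gt0 ?mulr_gt0 ?exprn_gt0 //.
  apply: le_trans S1; rewrite big_distrl /= le_eqVlt; apply/orP; left; apply/eqP.
  apply: eq_bigr => i _; rewrite -expr_div_n; congr (_ ^+ 2).
  by rewrite -[RHS]mulrA -invfM [q ^+ t * _]mulrC.
have tV0 : 0 <= (t%:R : R)^-1 by rewrite invr_ge0.
apply: le_trans (ge0_ler_powR tV0 _ _ nq) _; rewrite ?nnegrE ?sqrtr_ge0 ?exprn_ge0 ?(ltW q0) //.
by rewrite -powR_mulrn ?(ltW q0) // -powRrM mulfV ?pnatr_eq0 -?lt0n // powRr1 // ltW.
Unshelve. all: by end_near.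
Qed.
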